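(* Let $m\ge1$ be an integer, let $c$ be a nonzero real number, and let $\boldsymbol a,\boldsymbol a',\boldsymbol b,\boldsymbol b'$ be real tuples of sizes $i,i',j,j'\ge0$ respectively. Assume that $${}_jF_i\left(\begin{smallmatrix}-2m\boldsymbol b\\ -2m\boldsymbol a\end{smallmatrix};x\right)\,{}_jF_i\left(\begin{smallmatrix}-2m\boldsymbol b\\ -2m\boldsymbol a\end{smallmatrix};-x\right)={}_{j'}F_{i'}\left(\begin{smallmatrix}-m\boldsymbol b'\\ -m\boldsymbol a'\end{smallmatrix};cx^2\right).$$ Then $$\mathrm{Sym}\left(\mathcal H_{2m}\left[\begin{smallmatrix}\boldsymbol b\\ \boldsymbol a\end{smallmatrix}\right]\right)=\operatorname{Dil}_{2\sqrt{c(-1)^{i'+j'+1}}}\ \mathcal H_m^E\left[\begin{smallmatrix}\boldsymbol b',\ 1-\frac1{2m}\\ \boldsymbol a'\end{smallmatrix}\right].$$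
   Context: $\mathcal P_n$ is the set of monic polynomials of degree $n$ over $\mathbb C$. For $p\in\mathcal P_n$ the coefficients $\mathsf e_k(p)$ are defined by $p(x)=\sum_{k=0}^n x^{n-k}(-1)^k\mathsf e_k(p)$. For a nonzero complex scalar $\alpha$, $[\operatorname{Dil}_\alpha p](x)=\alpha^np(\alpha^{-1}x)$. (For an even polynomial of even degree, $\operatorname{Dil}_\alpha$ and $\operatorname{Dil}_{-\alpha}$ agree, so the choice of square root, possibly complex, is immaterial.) Falling and rising factorials: $(a)^{\underline k}=a(a-1)\cdots(a-k+1)$, $(a)^{\overline k}=a(a+1)\cdots(a+k-1)$; for tuples these denote products over the entries (equal to $1$ for the empty tuple), and $c\boldsymbol a$ denotes entrywise multiplication. Generalized hypergeometric series: ${}_jF_i\left(\begin{smallmatrix}\boldsymbol b\\ \boldsymbol a\end{smallmatrix};x\right)=\sum_{k\ge0}\frac{(\boldsymbol b)^{\overline k}}{(\boldsymbol a)^{\overline k}}\frac{x^k}{k!}$, regarded as a formal power series; the assumed identity is one of formal power series in $x$ and includes the assumption that the series are well defined (no denominator vanishes). Hypergeometric polynomials: for a real tuple $\boldsymbol b$ and a real tuple $\boldsymbol a$ with no entry in $\{0,\frac1n,\dots,\frac{n-1}n\}$, $\mathcal H_n\left[\begin{smallmatrix}\boldsymbol b\\ \boldsymbol a\end{smallmatrix}\right]\in\mathcal P_n$ is the monic polynomial with $\mathsf e_k=\binom nk\frac{(n\boldsymbol b)^{\underline k}}{(n\boldsymbol a)^{\underline k}}$, $0\le k\le n$. Its even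 version is $\mathcal H_m^E\left[\begin{smallmatrix}\boldsymbol b\\ \boldsymbol a\end{smallmatrix}\right](x)=\mathcal H_m\left[\begin{smallmatrix}\boldsymbol b\\ \boldsymbol a\end{smallmatrix}\right](x^2)\in\mathcal P_{2m}$. Finite free additive convolution on $\mathcal P_n$: $\mathsf e_k(p\boxplus_n q)=(n)^{\underline k}\sum_{i+j=k}\frac{\mathsf e_i(p)\mathsf e_j(q)}{(n)^{\underline i}(n)^{\underline j}}$ for $0\le k\le n$. The symmetrization of $p\in\mathcal P_n$ is $\mathrm{Sym}(p)=p\boxplus_n(\operatorname{Dil}_{-1}p)$. *)

(* Defs.v *)
From mathcomp Require Import all_boot all_order all_algebra.
From mathcomp Require Import reals complex.

Set Implicit Arguments.
Unset Strict Implicit.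
Unset Printing Implicit Defensive.

Import Order.TTheory GRing.Theory Num.Theory.
Local Open Scope ring_scope.
Local Open Scope complex_scope.

Section Factorials.
Variable F : fieldType.
Implicit Types (a c : F) (s : seq F) (k : nat).

Definition falling a k : F := \prod_(l < k) (a - l%:R).
Definition rising a k : F := \prod_(l < k) (a + l%:R).

Definition tfalling s k : F := \prod_(a <- s) falling a k.
Definition trising s k : F := \prod_(a <- s) rising a k.

Definition tscale c s : seq F := [seq c * a | a <- s].

End Factorials.

(* A formal power series is its sequence of coefficients. *)
Section FormalPowerSeries.
Variable F : fieldType.
Implicit Types (f g : nat -> F) (a b : seq F).

Definition fps_mul f g : nat -> F :=
  fun k => \sum_(l < k.+1) f l * g (k - l)%N.

(* f(d x^r), for r > 0 *)
Definition fps_comp_monom f (d : F) (r : nat) : nat -> F :=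
  fun k => if (r %| k)%N then f (k %/ r)%N * d ^+ (k %/ r) else 0.

(* Upper parameters first: hyper_series b a is the series with the tuple b in
   the numerator and the tuple a in the denominator. *)
Definition hyper_series b a : nat -> F :=
  fun k => trising b k / trising a k / k`!%:R.

Definition hyper_series_defined a : Prop := forall k, trising a k != 0.

End FormalPowerSeries.

Section FiniteFree.
Variable C : fieldType.
Implicit Types (p q : {poly C}) (n k : nat).

(* Monic polynomials of degree n *)
Definition in_P n p : bool := (p \is monic) && (size p == n.+1).

Definition e_coef n p k : C := (-1) ^+ k * p`_(n - k).

Definition poly_of_e n (e : nat -> C) : {poly C} :=
  \sum_(k < n.+1) ((-1) ^+ k * e k) *: 'X^(n - k).

Definition Dil n (al : C) p : {poly C} := al ^+ n *: (p \Po (al^-1 *: 'X)).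

Definition boxplus_e n p q k : C :=
  falling n%:R k * \sum_(l < k.+1)
    e_coef n p l * e_coef n q (k - l) / (falling n%:R l * falling n%:R (k - l)).

Definition boxplus n p q : {poly C} := poly_of_e n (boxplus_e n p q).

Definition Sym n p : {poly C} := boxplus n p (Dil n (-1) p).

Lemma coef_poly_of_e n e k :
  (poly_of_e n e)`_k = if (k <= n)%N then (-1) ^+ (n - k) * e (n - k)%N else 0.
Proof.
rewrite /poly_of_e coef_sum; case: leqP => hk.
  have hk' : (n - k < n.+1)%N by rewrite ltnS leq_subr.
  rewrite (bigD1 (Ordinal hk')) //= coefZ coefXn subKn // eqxx mulr1.
  rewrite big1 ?addr0 // => l hl; rewrite coefZ coefXn.
  case: eqP => [kE|]; last by rewrite mulr0.
  by case/eqP: hl; apply: val_inj; rewrite /= kE subKn // -ltnS.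
rewrite big1 // => l _; rewrite coefZ coefXn gtn_eqF ?mulr0 //.
exact: leq_ltn_trans (leq_subr _ _) hk.
Qed.

Lemma e_coef_poly_of_e n e k : (k <= n)%N -> e_coef n (poly_of_e n e) k = e k.
Proof.
by move=> hk; rewrite /e_coef coef_poly_of_e leq_subr subKn // mulrA -exprMn
  mulrNN mul1r expr1n mul1r.
Qed.

Lemma poly_of_e_in_P n e : e 0%N = 1 -> in_P n (poly_of_e n e).
Proof.
move=> e0; have sz : size (poly_of_e n e) = n.+1.
  apply/eqP; rewrite eqn_leq; apply/andP; split.
    by apply/leq_sizeP => k hk; rewrite coef_poly_of_e leqNgt hk.
  rewrite ltnNge; apply/negP => /leq_sizeP /(_ n (leqnn _)) /eqP.
  by rewrite coef_poly_of_e leqnn subnn mul1r e0 oner_eq0.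
by rewrite /in_P sz eqxx andbT monicE lead_coefE sz /= coef_poly_of_e leqnn subnn
  mul1r e0.
Qed.

Lemma boxplus_in_P n p q : in_P n p -> in_P n q -> in_P n (boxplus n p q).
Proof.
move=> /andP[/monicP mp /eqP sp] /andP[/monicP mq /eqP sq].
apply: poly_of_e_in_P; rewrite /boxplus_e big_ord1 /falling !big_ord0.
rewrite /e_coef !subn0 !mul1r divr1.
by move: mp mq; rewrite !lead_coefE sp sq /= => -> ->; rewrite mulr1.
Qed.

End FiniteFree.

Section HypergeometricPolynomials.
Variable R : realType.
Implicit Types (a b : seq R) (n m : nat).

(* No entry of a may lie in {0, 1/n, ..., (n-1)/n}; otherwise some
   denominators below vanish. *)
Definition hyper_poly n b a : {poly R[i]} :=
  poly_of_e n (fun k =>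
    ('C(n, k)%:R * (tfalling (tscale n%:R b) k / tfalling (tscale n%:R a) k))%:C).

Definition hyper_poly_even m b a : {poly R[i]} := hyper_poly m b a \Po 'X^2.

Lemma hyper_poly_in_P n b a : in_P n (hyper_poly n b a).
Proof.
apply: poly_of_e_in_P; rewrite bin0 mul1r /tfalling.
by rewrite !big1 ?divr1 // => x _; rewrite /falling big_ord0.
Qed.

(* If the series with lower tuple -na is well defined, then a is an admissible
   lower tuple for the polynomials of degree n. *)
Lemma hyper_series_defined_admissible n a :
  hyper_series_defined (tscale (- n%:R) a) ->
  forall k, tfalling (tscale n%:R a) k != 0.
Proof.
move=> wd k; have := wd k; rewrite /trising /tfalling /tscale !big_map.
rewrite !prodf_seq_neq0 => /allP h; apply/allP => x /h /=.
rewrite /rising /falling !prodf_seq_neq0 => /allP h'; apply/allP => l /h' /=.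
by rewrite mulNr addrC -opprB oppr_eq0.
Qed.

End HypergeometricPolynomials.

(* Main.v *)
Require Import Defs.
From mathcomp Require Import all_boot all_order all_algebra.
From mathcomp Require Import reals complex.
From mathcomp Require Import ring.

(** Write [N] for the degree of a hypergeometric polynomial [p] with upper tuple
    [b] and lower tuple [a].  Since a falling factorial of [x] is, up to the
    sign [(-1) ^+ k], the rising factorial of [- x], the normalized coefficients
    [e_k(p) / falling N k] are, up to the sign
    [((-1) ^+ (size a + size b)) ^+ k], the coefficients of the hypergeometric
    series with tuples [- N b] and [- N a] ([e_coef_hyper_poly]).  The finite free
    convolution is the Cauchy product of normalized coefficients, and
    [Dil N (-1)] corresponds to the substitution of [- x] for [x]; hence the
    normalized coefficients of [Sym N p] are, up to the same sign, those of the
    product [f(x) f(- x)] of the series [f] of [p] with its reflection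
    ([e_coef_Sym_hyper_poly]).

    For [N = 2m] the hypothesis evaluates this product as an even series: the
    coefficients [e_k] of [Sym p] with [k] odd vanish, and [e_(2r)] is
    [falling 2m 2r] times the [r]-th coefficient of the series in the primed
    tuples, times [c ^+ r].  The duplication formula
    [falling 2m 2r = 4 ^+ r * falling m r * falling (m - 1/2) r]
    ([falling_double]) turns this into the coefficient of the polynomial in the
    primed tuples with the additional upper parameter [1 - 1/(2m)], for which
    [m (1 - 1/(2m)) = m - 1/2]; the factor [4 ^+ r * c ^+ r] and the signs are
    those of the dilation by [2 s]. *)

Import Order.TTheory GRing.Theory Num.Theory.
Local Open Scope ring_scope.
Local Open Scope complex_scope.

Lemma fallingE (F : fieldType) (a : F) k :
  falling a k = (-1) ^+ k * rising (- a) k.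
Proof.
rewrite /falling /rising -[k in (-1) ^+ k]card_ord -prodr_const -big_split /=.
by apply: eq_bigr => l _; rewrite mulN1r opprD opprK.
Qed.

Lemma fallingS (F : fieldType) (a : F) k :
  falling a k.+1 = falling a k * (a - k%:R).
Proof. by rewrite /falling big_ord_recr. Qed.

Lemma tfallingE (F : fieldType) (c : F) s k :
  tfalling (tscale c s) k = (-1) ^+ (size s * k) * trising (tscale (- c) s) k.
Proof.
rewrite /tfalling /trising /tscale !big_map; elim: s => [|x s IHs].
  by rewrite !big_nil mulr1.
by rewrite !big_cons IHs fallingE mulNr mulSn exprD mulrACA.
Qed.

Lemma falling_natr (F : fieldType) n k :
  falling (n%:R : F) k = (n ^_ k)%:R.
Proof.
elim: k => [|k IHk]; first by rewrite /falling big_ord0.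
rewrite fallingS IHk ffactnSr natrM.
have [lekn|ltnk] := leqP k n; first by rewrite natrB.
by rewrite ffact_small // !mul0r.
Qed.

Lemma falling_double (F : fieldType) (x : F) r : (2%:R : F) != 0 ->
  falling (2%:R * x) (2 * r) = 4%:R ^+ r * falling x r * falling (x - 2%:R^-1) r.
Proof.
move=> nz2; elim: r => [|r IHr]; first by rewrite /falling !big_ord0 !mulr1.
rewrite mulnS !addSn add0n !fallingS IHr exprSr mul2n -addnn -natr1 natrD.
by field.
Qed.

Section ECoef.
Variable C : fieldType.
Implicit Types (p q : {poly C}) (n k : nat).

(** A polynomial of degree at most [n] is determined by its coefficients
    [e_coef n]. *)
Lemma e_coef_inj n p q : (size p <= n.+1)%N -> (size q <= n.+1)%N ->
  (forall k, (k <= n)%N -> e_coef n p k = e_coef n q k) -> p = q.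
Proof.
move=> sp sq eqe; apply/polyP => i; have [lein|ltni] := leqP i n; last first.
  by rewrite !nth_default //; apply: leq_trans ltni.
have := eqe (n - i)%N (leq_subr _ _); rewrite /e_coef subKn //.
by apply: mulfI; rewrite signr_eq0.
Qed.

Lemma coef_comp_scaleX p (c : C) k : (p \Po (c *: 'X))`_k = c ^+ k * p`_k.
Proof.
elim/poly_ind: p k => [|p a IHp] k; first by rewrite comp_poly0 !coef0 mulr0.
rewrite comp_polyD comp_polyM comp_polyX comp_polyC !coefD !coefC.
rewrite -scalerAr coefZ !coefMX; case: k => [|k] /=.
  by rewrite mulr0 mul1r.
by rewrite IHp !addr0 exprS mulrA.
Qed.

Lemma e_coef_Dil n (al : C) p k : al != 0 -> (k <= n)%N ->
  e_coef n (Dil n al p) k = al ^+ k * e_coef n p k.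
Proof.
move=> nz_al lekn; rewrite /e_coef /Dil coefZ coef_comp_scaleX [RHS]mulrCA.
congr (_ * _); rewrite mulrA; congr (_ * _).
by rewrite exprVn -{1}(subnKC lekn) exprD mulfK // expf_neq0.
Qed.

Lemma size_Dil n (al : C) p d :
  (size p <= d)%N -> (size (Dil n al p) <= d)%N.
Proof.
move=> /leq_sizeP sp; apply/leq_sizeP => k lenk.
by rewrite coefZ coef_comp_scaleX sp // !mulr0.
Qed.

Lemma e_coef_comp_Xsq m p r : (r <= m)%N ->
  e_coef (2 * m) (p \Po 'X^2) (2 * r) = (-1) ^+ r * e_coef m p r.
Proof.
move=> lerm; rewrite /e_coef -mulnBr coef_comp_poly_Xn // dvdn_mulr // mulKn //.
by rewrite exprM sqrrN !expr1n mulrA -exprD addnn -mul2n exprM sqrrN !expr1n.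
Qed.

Lemma e_coef_comp_Xsq_odd m p k : odd k -> (k <= 2 * m)%N ->
  e_coef (2 * m) (p \Po 'X^2) k = 0.
Proof.
move=> ok lek; rewrite /e_coef coef_comp_poly_Xn // dvdn2 oddB // ok.
by rewrite mul2n odd_double mulr0.
Qed.

Lemma size_poly_of_e n (e : nat -> C) : (size (poly_of_e n e) <= n.+1)%N.
Proof. by apply/leq_sizeP => k ltnk; rewrite coef_poly_of_e leqNgt ltnk. Qed.

(** Up to the normalization by falling factorials, [Sym] multiplies the
    generating series of [p] by its reflection. *)
Lemma e_coef_Sym n p k : (k <= n)%N ->
  e_coef n (Sym n p) k = falling n%:R k * fps_mul
    (fun l => e_coef n p l / falling n%:R l)
    (fun l => (-1) ^+ l * (e_coef n p l / falling n%:R l)) k.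
Proof.
move=> lekn; rewrite e_coef_poly_of_e // /boxplus_e; congr (_ * _).
apply: eq_bigr => l _.
have lekln : (k - l <= n)%N by apply: leq_trans lekn; rewrite leq_subr.
rewrite e_coef_Dil ?oppr_eq0 ?oner_eq0 // invfM mulrACA.
by rewrite -[X in _ * X]mulrA.
Qed.

End ECoef.

Section Hyper.
Variable R : realType.
Implicit Types (a b : seq R).

(** Division by zero being total, the identity needs no condition on [a]: both
    sides vanish together when a denominator does. *)
Lemma hyper_ratio n b a k : (k <= n)%N ->
  'C(n, k)%:R * (tfalling (tscale n%:R b) k / tfalling (tscale n%:R a) k) =
  falling n%:R k * (((-1) ^+ (size a + size b)) ^+ k *
    hyper_series (tscale (- n%:R) b) (tscale (- n%:R) a) k).
Proof.
move=> lekn; rewrite !tfallingE falling_natr -bin_ffact natrM /hyper_series.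
have nzk : k`!%:R != 0 :> R by rewrite pnatr_eq0 -lt0n fact_gt0.
rewrite invfM -!exprM invr_sign mulnDl exprD.
by set u := (trising _ _)^-1; field.
Qed.

Lemma e_coef_hyper_poly n b a k : (k <= n)%N ->
  e_coef n (hyper_poly n b a) k / falling n%:R k =
  (((-1) ^+ (size a + size b)) ^+ k *
    hyper_series (tscale (- n%:R) b) (tscale (- n%:R) a) k)%:C.
Proof.
move=> lekn; rewrite e_coef_poly_of_e // hyper_ratio //.
rewrite (rmorphM (real_complex R)) /= falling_natr.
rewrite falling_natr (rmorph_nat (real_complex R)) mulrC mulKf //.
by rewrite pnatr_eq0 -lt0n ffact_gt0.
Qed.

Lemma e_coef_Sym_hyper_poly n b a k : (k <= n)%N ->
  let f := hyper_series (tscale (- n%:R) b) (tscale (- n%:R) a) in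
  e_coef n (Sym n (hyper_poly n b a)) k =
  (falling n%:R k * (((-1) ^+ (size a + size b)) ^+ k *
    fps_mul f (fps_comp_monom f (-1) 1) k))%:C.
Proof.
move=> lekn f; rewrite e_coef_Sym // (rmorphM (real_complex R)) /=.
rewrite !falling_natr (rmorph_nat (real_complex R)); congr (_ * _).
rewrite /fps_mul mulr_sumr (rmorph_sum (real_complex R)) /=.
apply: eq_bigr => l _; have lelk : (l <= k)%N by rewrite -ltnS.
rewrite !e_coef_hyper_poly ?(leq_trans _ lekn) ?leq_subr //.
rewrite -(rmorph_sign (real_complex R)).
rewrite -!(rmorphM (real_complex R)) /=; congr (_%:C).
rewrite /fps_comp_monom dvd1n divn1 -/f.
set eps := (-1) ^+ (_ + _).
have -> : eps ^+ k = eps ^+ l * eps ^+ (k - l) by rewrite -exprD subnKC.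
ring.
Qed.

End Hyper.

Theorem lemma4p7 (R : realType) (m : nat) (c : R) (si si' sj sj' : nat)
    (a : si.-tuple R) (a' : si'.-tuple R) (b : sj.-tuple R) (b' : sj'.-tuple R) :
  (1 <= m)%N ->
  c != 0 ->
  hyper_series_defined (tscale (- (2 * m)%:R) a) ->
  hyper_series_defined (tscale (- m%:R) a') ->
  fps_mul
    (hyper_series (tscale (- (2 * m)%:R) b) (tscale (- (2 * m)%:R) a))
    (fps_comp_monom
       (hyper_series (tscale (- (2 * m)%:R) b) (tscale (- (2 * m)%:R) a)) (-1) 1)
  =1 fps_comp_monom
       (hyper_series (tscale (- m%:R) b') (tscale (- m%:R) a')) c 2 ->
  (* s is any complex square root of c(-1)^(i'+j'+1) *)
  forall s : R[i], s ^+ 2 = (c * (-1) ^+ (si' + sj' + 1))%:C ->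
  Sym (2 * m) (hyper_poly (2 * m) b a) =
  Dil (2 * m) (2 * s)
    (hyper_poly_even m (rcons b' (1 - (2 * m)%:R^-1)) a').
Proof.
move=> m_gt0 nz_c _ _ eq_series s sqr_s.
have nz_s : 2 * s != 0.
  rewrite mulf_eq0 pnatr_eq0 /= -sqrf_eq0 sqr_s (fmorph_eq0 (real_complex R)).
  by rewrite mulf_neq0 ?signr_eq0.
apply: (@e_coef_inj _ (2 * m)); first exact: size_poly_of_e.
  apply/size_Dil/leq_sizeP => k; rewrite coef_comp_poly_Xn //.
  case: ifP => // /dvdnP[r ->].
  rewrite [(r * 2)%N]mulnC mulKn // ltn_pmul2l // => ltmr.
  by rewrite coef_poly_of_e leqNgt ltmr.
move=> k lek; rewrite e_coef_Dil // e_coef_Sym_hyper_poly // eq_series.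
rewrite /fps_comp_monom dvdn2; case: (boolP (odd k)) => /= [ok | /even_halfK Ek].
  by rewrite !mulr0 e_coef_comp_Xsq_odd // mulr0.
have {lek Ek} [r -> lerm] : exists2 r, k = (2 * r)%N & (r <= m)%N.
  by exists k./2; rewrite ?mul2n ?Ek // -(leq_pmul2l (isT : 0 < 2)%N) mul2n Ek.
rewrite mulKn // e_coef_comp_Xsq // e_coef_poly_of_e // [(2 * s) ^+ _]exprM.
rewrite [(2 * s) ^+ 2]exprMn sqr_s.
(* The additional upper parameter contributes m (1 - 1/(2m)) = m - 1/2. *)
have -> : tfalling (tscale m%:R (rcons b' (1 - (2 * m)%:R^-1))) r =
    tfalling (tscale m%:R b') r * falling (m%:R - 2^-1) r :> R.
  rewrite /tfalling /tscale !big_map big_rcons mulrC; congr (_ * falling _ _).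
  by rewrite natrM; field; rewrite !pnatr_eq0 -lt0n m_gt0.
rewrite [_ * _ / _]mulrAC ['C(m, r)%:R * _]mulrA hyper_ratio // !size_tuple.
rewrite -(rmorph_sign (real_complex R) r) -natrX.
rewrite -(rmorph_nat (real_complex R)) -!(rmorphM (real_complex R)).
rewrite -(rmorphXn (real_complex R)) -!(rmorphM (real_complex R)) /=.
congr (_%:C).
rewrite [(_ ^+ _) ^+ (2 * r)]exprM sqrr_sign expr1n mul1r.
rewrite [(2 * m)%:R]natrM falling_double ?pnatr_eq0 //.
rewrite exprD expr1; set eps := (-1) ^+ (si' + sj').
(* The sign of s ^+ 2, the sign of the hypergeometric coefficients and the one
   coming from the substitution of X^2 cancel. *)
have sgn1 : eps ^+ r * eps ^+ r * ((-1) ^+ r * (-1) ^+ r) = 1.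
  by rewrite -!exprMn mulrNN !mulr1 !expr1n.
rewrite -[LHS]mulr1 -[X in _ * X = _]sgn1 !exprMn.
by move: (eps ^+ r) ((-1) ^+ r) (4 ^+ r) => u v w; ring.
Qed.
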